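(* Let $G$ be a finite $d$-regular graph with $d\ge 1$, all of whose (adjacency) eigenvalues are algebraic integers of degree at most two, written in the form $\lambda_r=a+b\sqrt{m_r}$ with $a,b\in\mathbb{Q}$ and $m_r\neq 1$ a square-free integer ($a,b$ depending on $r$). Let $S(G)$ denote the subdivision graph of $G$. Then the bipartite walk defined over $S(G)$ is periodic if and only if every eigenvalue $\lambda_r=a+b\sqrt{m_r}$ of $G$ satisfies both of the following: (a) if $b=0$, then $\lambda_r\in\{0,\ \pm d,\ \pm\frac12 d\}$; (b) if $b\ne 0$, then $\lambda_r\in\Big\{\pm\frac{\sqrt2}{2}d,\ \pm\frac{\sqrt3}{2}d,\ \frac{1\pm\sqrt5}{4}d,\ \frac{-1\pm\sqrt5}{4}d\Big\}$. (Moreover, the eigenvalues of $G$ come in algebraic conjugate pairs.)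
   Context: All graphs are finite and simple. The subdivision graph $S(G)$ is obtained from $G$ by subdividing every edge exactly once; it is bipartite with color classes $C_0=V(S(G))\setminus V(G)$ and $C_1=V(G)$. Bipartite walk: for a bipartite graph $H$ with color classes $C_0,C_1$, let $\pi_0$ (resp. $\pi_1$) be the partition of $E(H)$ in which two edges are in the same cell if and only if they have the same end in $C_0$ (resp. $C_1$). Let $P$ (resp. $Q$) be the orthogonal projection of $\mathbb{C}^{E(H)}$ onto the vectors that are constant on the cells of $\pi_0$ (resp. $\pi_1$). The transition matrix of the bipartite walk over $H$ is $U=(2P-I)(2Q-I)$. The walk is periodic if $U^k=I$ for some positive integer $k$. *)

(* Defs.v *)
From HB Require Import structures.
From mathcomp Require Import all_boot all_order all_algebra.
Set Implicit Arguments.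
Unset Strict Implicit.
Unset Printing Implicit Defensive.
Import Order.TTheory GRing.Theory Num.Theory.
Local Open Scope ring_scope.

Record sgraph := SGraph {
  vertex :> finType;
  adj : rel vertex;
  adj_sym : symmetric adj;
  adj_irr : irreflexive adj }.

Definition edges (G : sgraph) : {set {set G}} :=
  [set [set p.1; p.2] | p : G * G & adj p.1 p.2].

Definition regular (G : sgraph) (d : nat) : Prop :=
  forall x : G, #|[set y | adj x y]| = d.

Definition adjmx (C : numClosedFieldType) (G : sgraph) : 'M[C]_#|G| :=
  \matrix_(i, j) (adj (enum_val i) (enum_val j))%:R.

Section Subdivision.
Variable G : sgraph.

(* The new vertex subdividing the edge f of G is [inr f]. *)
Definition subdiv_vertex : finType := (G + {f : {set G} | f \in edges G})%type.

Definition subdiv_adj (u v : subdiv_vertex) : bool :=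
  match u, v with
  | inl x, inr f => x \in val f
  | inr f, inl x => x \in val f
  | _, _ => false
  end.

Lemma subdiv_adj_sym : symmetric subdiv_adj.
Proof. by move=> [x|f] [y|g]. Qed.

Lemma subdiv_adj_irr : irreflexive subdiv_adj.
Proof. by move=> [x|f]. Qed.

Definition subdiv : sgraph := SGraph subdiv_adj_sym subdiv_adj_irr.

Definition subdiv_C1 : {set subdiv} :=
  [set u : subdiv_vertex | if u is inl _ then true else false].
Definition subdiv_C0 : {set subdiv} := ~: subdiv_C1.

End Subdivision.

Definition bipartition (H : sgraph) (C0 C1 : {set H}) : Prop :=
  [/\ C0 :|: C1 = [set: H], C0 :&: C1 = set0 &
      forall x y : H, adj x y -> (x \in C0) = (y \in C1)].

Lemma subdiv_bipartition (G : sgraph) :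
  bipartition (subdiv_C0 G) (subdiv_C1 G).
Proof.
split; first by rewrite setUC setUCr.
- by rewrite setIC setICr.
- by move=> [x|f] [y|g] //; rewrite !inE.
Qed.

(* When B is a color class of the bipartite graph H, an edge f has exactly one
   end in B, so that f :&: B determines this end and is determined by it. *)
Definition end_partition (H : sgraph) (B : {set H}) : {set {set {set H}}} :=
  preim_partition (fun f : {set H} => f :&: B) (edges H).

Lemma end_partitionP (H : sgraph) (B : {set H}) :
  partition (end_partition B) (edges H).
Proof. exact: preim_partitionP. Qed.

Section BipartiteWalk.
Variable C : numClosedFieldType.

(* The vectors of C^E, for E a finite set, are indexed by [enum_val].  The rows
   of [cell_mx E pi] are the indicator vectors of the cells of pi. *)
Definition cell_mx (T : finType) (E : {set T}) (pi : {set {set T}}) :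
    'M[C]_(#|pi|, #|E|) :=
  \matrix_(i < #|pi|, j < #|E|) (enum_val j \in enum_val i)%:R.

Definition const_on_cells (T : finType) (E : {set T}) (pi : {set {set T}})
    (v : 'rV[C]_#|E|) : Prop :=
  forall A, A \in pi -> forall i j : 'I_#|E|,
    enum_val i \in A -> enum_val j \in A -> v 0 i = v 0 j.

Lemma cell_mxP (T : finType) (E : {set T}) (pi : {set {set T}})
    (v : 'rV[C]_#|E|) :
  partition pi E -> (v <= cell_mx E pi)%MS <-> const_on_cells pi v.
Proof.
move=> /and3P[/eqP covE triv _]; split.
  move=> /submxP[w ->] A piA i j iA jA; rewrite !mxE.
  apply: eq_bigr => k _; rewrite !mxE; congr (_ * (nat_of_bool _)%:R).
  have tk B : B \in pi -> B != A -> forall x, x \in A -> (x \in B) = false.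
    move=> piB neqBA x xA; apply/negbTE/negP => xB.
    by move: (trivIsetP triv _ _ piB piA neqBA) => /disjointFr/(_ xB); rewrite xA.
  have [->|neq] := eqVneq (enum_val k) A; first by rewrite iA jA.
  by rewrite !(tk _ _ neq) // enum_valP.
move=> vc; pose w : 'rV[C]_#|pi| := \row_(k < #|pi|)
  (if [pick i : 'I_#|E| | enum_val i \in enum_val k] is Some i then v 0 i else 0).
apply/submxP; exists w; apply/rowP => j; rewrite !mxE.
have : enum_val j \in cover pi by rewrite covE enum_valP.
move=> /bigcupP[A piA jA]; rewrite (bigD1 (enum_rank_in piA A)) //=.
rewrite !mxE enum_rankK_in // jA mulr1 big1 ?addr0.
  case: pickP => [i iA|/(_ j)]; last by rewrite jA.
  exact: (vc A).
move=> k neq; rewrite !mxE; have neqA : enum_val k != A.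
  apply: contraNneq neq => eqA; apply/eqP/enum_val_inj.
  by rewrite eqA enum_rankK_in.
move: (trivIsetP triv _ _ (enum_valP k) piA neqA) => /disjointFl/(_ jA) ->.
by rewrite mulr0.
Qed.

(* [proj_ortho] acts on row vectors, by right multiplication; the transpose is
   the same orthogonal projection acting on column vectors. *)
Definition const_proj (T : finType) (E : {set T}) (pi : {set {set T}}) :
    'M[C]_#|E| := (proj_ortho (cell_mx E pi))^T.

Definition bipartite_walk (H : sgraph) (C0 C1 : {set H}) : 'M[C]_#|edges H| :=
  let P := const_proj (edges H) (end_partition C0) in
  let Q := const_proj (edges H) (end_partition C1) in
  (2%:R *: P - 1%:M) *m (2%:R *: Q - 1%:M).

Definition periodic (n : nat) (U : 'M[C]_n) : Prop :=
  exists2 k : nat, (0 < k)%N & U ^+ k = 1%:M.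

Definition is_minPoly (p : {poly rat}) (x : C) : Prop :=
  [/\ p \is monic, irreducible_poly p & root (map_poly ratr p) x].

Definition algint_deg_le (n : nat) (x : C) : Prop :=
  integralOver (intr : int -> C) x /\
  exists2 p : {poly rat}, is_minPoly p x & ((size p).-1 <= n)%N.

End BipartiteWalk.

Definition squarefree (m : int) : Prop :=
  forall k : int, (k ^+ 2 %| m)%Z -> `|k| = 1.

(* Main.v *)
Require Import Defs.
From HB Require Import structures.
From mathcomp Require Import all_boot all_order all_algebra.
From mathcomp Require Import ring lra zify.
Set Implicit Arguments.
Unset Strict Implicit.
Unset Printing Implicit Defensive.
Import Order.TTheory GRing.Theory Num.Theory.
Local Open Scope ring_scope.

(* Let D and D0 be the incidence matrices of the edges of S(G) with the two color
   classes C1 = V(G) and C0.  Then D^T D = d, D0^T D0 = 2, and the walk is U = R S with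
   R = D0 D0^T - 1 and S = (2/d) D D^T - 1, two symmetric involutions such that
   D^T R D is the adjacency matrix A.  Hence D intertwines U and A: an eigenvalue
   z of U with z^2 <> 1 corresponds to an eigenvalue (d/2)(z + 1/z) of A, and
   conversely.  As U is unitary, hence diagonalizable, U is periodic iff every
   t = 2 lam / d is of the form z + 1/z with z a root of unity.  Such a t is a real
   algebraic integer in [-2, 2].  If t is rational this leaves five integers.
   If t is quadratic, its conjugate t' comes from another eigenvalue of A, hence
   is also in [-2, 2], and t + t', t t' are integers: this leaves
   X^2 - 2, X^2 - 3 and X^2 +- X - 1 as minimal polynomials of t.  Conversely,
   for all these t, z is a root of unity of order dividing 120. *)

(** * Rational algebraic integers and conjugate quadratic irrationals *)

(** By Gauss's lemma ['X - x%:P] is [a] times an integer factor [p1] of the monic [p]. The leading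
    coefficients of [p1] and of the cofactor [r] have product 1, so [a] is the one of [r], an
    integer. *)
Lemma integral_ratr_int (F : numFieldType) (x : rat) :
  integralOver (intr : int -> F) (ratr x) -> exists n : int, x = n%:~R.
Proof.
move=> [p p_mon]; rewrite -(eq_map_poly (ratr_int F)) map_poly_comp fmorph_root.
rewrite root_factor_theorem => /dvdpP_rat_int[p1 [a a0 Dx] [r Dp]].
have lc1 : (lead_coef p1 * lead_coef r)%:~R = 1 :> rat.
  by rewrite -lead_coefM -Dp (monicP p_mon).
have a_lc : a * (lead_coef p1)%:~R = 1.
  rewrite -[RHS](lead_coefXsubC x) Dx lead_coefZ; congr (_ * _).
  by rewrite lead_coef_map_inj //; exact: intr_inj.
have Da : a = (lead_coef r)%:~R.
  by rewrite -[LHS]mulr1 -[X in a * X]lc1 intrM mulrA a_lc mul1r.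
exists (- (lead_coef r * p1`_0)); have /(congr1 (fun s : {poly rat} => - s`_0)) := Dx.
by rewrite coefB coefX coefC sub0r opprK coefZ coef_map Da -intrM mulrNz.
Qed.

(** A rational square root of [m] is integral, hence an integer [n]; its square divides [m], so
    squarefreeness forces [m] to be 1. *)
Lemma sqrtC_squarefree_irrational (C : numClosedFieldType) (m : int) (x : rat) :
  squarefree m -> m != 1 -> sqrtC m%:~R != ratr x :> C.
Proof.
move=> m_sqf m1; apply/eqP => sqrt_m.
have x2 : x ^+ 2 = m%:~R.
  apply: (fmorph_inj (ratr : rat -> C)).
  by rewrite rmorphXn /= -sqrt_m sqrtCK ratr_int.
have [|n Dx] := @integral_ratr_int C x.
  exists ('X^2 - m%:P); first by rewrite monicXnsubC.
  rewrite rmorphB /= map_polyXn map_polyC /= /root !hornerE.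
  by rewrite -rmorphXn /= x2 ratr_int subrr.
have n2 : n ^+ 2 = m by apply: (intr_inj (R := rat)); rewrite rmorphXn /= -Dx.
have n1 : `|n| = 1 by apply: m_sqf; rewrite n2 dvdzz.
by move/eqP: m1; apply; rewrite -n2 -real_normK ?num_real // n1 expr1n.
Qed.

(** The quadratic [q] acts as a common minimal polynomial of [x] and [y]: dividing [p] by [q] as
    often as possible lowers both multiplicities by one each time, and what is left vanishes at
    neither. *)
Lemma mup_conj_quadratic (F : numFieldType) (x y : F) (q : {poly rat}) :
    map_poly ratr q = ('X - x%:P) * ('X - y%:P) ->
    (forall r : rat, x != ratr r) -> (forall r : rat, y != ratr r) -> x != y ->
  forall p : {poly rat}, p != 0 ->
  mup x (map_poly ratr p) = mup y (map_poly ratr p).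
Proof.
move=> Dq x_irr y_irr x_y.
have Xs0 z : 'X - z%:P != 0 :> {poly F} by rewrite monic_neq0 ?monicXsubC.
have sz_q : size q = 3%N.
  rewrite -(size_map_poly (ratr : {rmorphism rat -> F})) Dq.
  by rewrite size_Mmonic ?Xs0 ?monicXsubC // !size_XsubC.
have q0 : q != 0 by rewrite -size_poly_eq0 sz_q.
(* The remainder modulo [q] is rational of degree at most one, so an irrational root makes it
   zero. *)
have dvd_q (z : F) (p : {poly rat}) : root (map_poly ratr q) z -> (forall r : rat, z != ratr r) ->
    root (map_poly ratr p) z -> (q %| p)%R.
  move=> qz z_irr pz; apply/modp_eq0P/eqP.
  have : root (map_poly ratr (p %% q)) z.
    move: pz; rewrite {1}(divp_eq p q) rmorphD /= rmorphM /= /root hornerD hornerM.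
    by rewrite (rootP qz) mulr0 add0r.
  have : (size (p %% q)%R <= 2)%N by rewrite -ltnS -sz_q ltn_modp.
  set s := p %% q => sz_s; have -> : s = (s`_1)%:P * 'X + (s`_0)%:P.
    apply/polyP => i; rewrite coefD coefMX !coefC.
    by case: i => [|[|i]]; rewrite ?add0r ?addr0 //= nth_default // (leq_trans sz_s).
  rewrite rmorphD /= rmorphM /= map_polyX !map_polyC /root !hornerE /=.
  have [->|s1] := eqVneq s`_1 0.
    rewrite rmorph0 mul0r add0r fmorph_eq0 => /eqP->.
    by rewrite !polyC0 mul0r addr0.
  move/eqP=> sz; case/negP: (z_irr (- s`_0 / s`_1)); apply/eqP.
  have s1F : ratr s`_1 != 0 :> F by rewrite fmorph_eq0.
  rewrite rmorphM fmorphV rmorphN /=; apply: (mulfI s1F).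
  by rewrite mulrCA divff // mulr1; apply/eqP; rewrite -addr_eq0 sz.
have root_q z : root (map_poly ratr q) z = (z == x) || (z == y).
  by rewrite Dq rootM !root_XsubC.
have mup1 (z u : F) : mup z ('X - u%:P) = (u == z).
  by rewrite -[X in mup z X]expr1 mup_XsubCX; case: ifP.
move=> p; have [n] := ubnP (size p); elim: n p => [p sz_p|n IHn p sz_p p0].
  by exfalso; rewrite ltn0 in sz_p.
have [/dvdpP[s Dp]|q'p] := boolP (q %| p)%R.
  have s0 : s != 0 by apply: contraNneq p0; rewrite Dp => ->; rewrite mul0r.
  have sF0 : map_poly ratr s != 0 :> {poly F} by rewrite map_poly_eq0.
  have qF0 : map_poly ratr q != 0 :> {poly F} by rewrite map_poly_eq0.
  have -> : map_poly ratr p = map_poly ratr s * map_poly ratr q :> {poly F}.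
    by rewrite Dp rmorphM.
  have mup_q : mup x (map_poly ratr q) = mup y (map_poly ratr q).
    rewrite Dq (mupM x (Xs0 x) (Xs0 y)) (mupM y (Xs0 x) (Xs0 y)) !mup1 !eqxx.
    by rewrite (eq_sym y) (negPf x_y).
  have mup_s : mup x (map_poly ratr s) = mup y (map_poly ratr s).
    apply: (IHn _ _ s0); rewrite -ltnS; apply: leq_trans sz_p.
    by rewrite Dp (size_mul s0 q0) [X in (_ + X).-1]sz_q addnC ltnS.
  by rewrite (mupM x sF0 qF0) (mupM y sF0 qF0) mup_q mup_s.
have q'root (z : F) : root (map_poly ratr q) z -> (forall r : rat, z != ratr r) ->
  ~~ root (map_poly ratr p) z by move=> qz z_irr; apply: contraNN q'p => /(dvd_q _ _ qz z_irr).
by rewrite (mupNroot (q'root x _ x_irr)) ?(mupNroot (q'root y _ y_irr)) // root_q eqxx ?orbT.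
Qed.

(** * Traces z + 1/z of roots of unity z *)

(** Since [z] has modulus 1, its inverse [w] is its complex conjugate, which gives reality and the
    bounds; [z] and [w] are both integral as roots of unity. *)
Lemma unit_root_trace (C : numClosedFieldType) (k : nat) (z w : C) :
    (0 < k)%N -> z ^+ k = 1 -> z * w = 1 ->
  [/\ integralOver (intr : int -> C) (z + w), z + w \is Num.real
    & -2%:R <= z + w <= 2%:R].
Proof.
move=> k_gt0 zk zw.
have norm1 : `|z| = 1.
  by apply/eqP; rewrite -(@pexpr_eq1 _ _ k) // -normrX zk normr1.
have z0 : z != 0 by rewrite -normr_eq0 norm1 oner_eq0.
have Dw : w = z^*.
  by apply: (mulfI z0); rewrite zw -normCK norm1 expr1n.
have wk : w ^+ k = 1 by rewrite Dw -rmorphXn zk rmorph1.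
have int1 (u : C) : u ^+ k = 1 -> integralOver (intr : int -> C) u.
  move=> uk; exists ('X^k - 1); first by rewrite monicXnsubC.
  by rewrite rmorphB /= map_polyXn rmorph1 /root !hornerE uk subrr.
have t_real : z + w \is Num.real.
  by apply/CrealP; rewrite rmorphD /= Dw conjCK addrC.
split=> //; first by apply: integral_add; apply: int1.
rewrite -real_ler_norml // (le_trans (ler_normD _ _)) //.
by rewrite Dw norm_conjC norm1.
Qed.

(** The roots 0, 1, -1, 2, -2 are the values of z + 1/z for z of order 4, 6, 3, 1, 2. *)
Definition rational_trace (R : pzRingType) (t : R) :=
  t * (t ^+ 2 - 1) * (t ^+ 2 - 4%:R).

(** The four factors are the minimal polynomials of z + 1/z for z of order 8, 12, 10 and 5. *)
Definition quadratic_trace (R : pzRingType) (t : R) :=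
  (t ^+ 2 - 2%:R) * (t ^+ 2 - 3%:R) * (t ^+ 2 - t - 1) * (t ^+ 2 + t - 1).

Lemma int_rational_trace (n : int) : -2 <= n <= 2 -> rational_trace n = 0.
Proof.
move=> n2.
have [->|[->|[->|[->|->]]]] : n = -2 \/ n = -1 \/ n = 0 \/ n = 1 \/ n = 2 by lia.
all: by [].
Qed.

Lemma rational_trace_intr (R : comPzRingType) (n : int) :
  rational_trace n = 0 -> rational_trace (n%:~R : R) = 0.
Proof.
move=> /(congr1 (fun m : int => m%:~R : R)); rewrite /rational_trace !(intrM, intrB, rmorphXn) /=.
by rewrite expr2.
Qed.

(* A monic integer quadratic with both roots in [-2, 2] either splits over the
   integers or is one of X^2 - 2, X^2 - 3, X^2 - X - 1, X^2 + X - 1. *)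
Lemma int_quadratic_trace (F : numFieldType) (p q : int) (t : F) :
    t ^+ 2 - p%:~R * t + q%:~R = 0 -> (forall n : int, t != n%:~R) ->
    0 <= 4 - 2 * p + q -> 0 <= 4 + 2 * p + q -> 4 * q <= p ^+ 2 ->
    -4 <= p <= 4 ->
  quadratic_trace t = 0.
Proof.
move=> Dt t_irr q1 q2 q3 p4.
(* If the quadratic splits over the integers, then [t] is an integer, against [t_irr]. *)
have split (i j : int) : p = i + j -> q = i * j -> quadratic_trace t = 0.
  move=> Dp Dq; have : (t - i%:~R) * (t - j%:~R) = 0.
    by rewrite -Dt Dp Dq !rmorphE; ring.
  by move/eqP; rewrite mulf_eq0 !subr_eq0 !(negPf (t_irr _)).
rewrite /quadratic_trace.
(* The pairs are the integer roots of the quadratics that split; the computation below confirms that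
   the list is complete. *)
pose splits := [seq (ij.1 + ij.2, ij.1 * ij.2) | ij : int * int <-
  [:: (0, 0); (1, -1); (2, -2); (1, 0); (2, -1); (-1, 0); (-2, 1);
      (1, 1); (2, 0); (-1, -1); (-2, 0); (2, 1); (-2, -1); (2, 2); (-2, -2)]].
have : (p, q) \in [:: (0, -2); (0, -3); (1, -1); (-1, -1)] ++ splits.
  pose range : seq int := [:: -4; -3; -2; -1; 0; 1; 2; 3; 4].
  have p_range : p \in range by rewrite !inE; lia.
  (* Adding [q1] and [q2] gives q >= -4, and [q3] gives q <= 4. *)
  have q_range : q \in range by rewrite !inE; nia.
  have : all (fun a => all (fun b => [&& 0 <= 4 - 2 * a + b, 0 <= 4 + 2 * a + b &
      4 * b <= a ^+ 2] ==> ((a, b) \in [:: (0, -2); (0, -3); (1, -1); (-1, -1)] ++ splits))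
      range) range by vm_compute.
  by move=> /allP/(_ _ p_range)/allP/(_ _ q_range)/implyP->; rewrite ?q1 ?q2.
rewrite mem_cat => /orP[|/mapP[[i j] _ [Dp Dq]]]; last exact: (split i j).
by rewrite !inE !xpair_eqE => /or4P[] /andP[/eqP Dp /eqP Dq];
  rewrite Dp Dq !rmorphE in Dt; apply/eqP; rewrite !mulf_eq0 -!orbA;
  apply/or4P; [apply: Or41|apply: Or42|apply: Or43|apply: Or44]; apply/eqP; rewrite -Dt; ring.
Qed.

(* 120 is the least common multiple of the orders 1, 2, 3, 4, 5, 6, 8, 10, 12 of z. *)
Lemma trace_unit_root (F : fieldType) (z t : F) :
    z ^+ 2 = t * z - 1 ->
    rational_trace t = 0 \/ quadratic_trace t = 0 -> z ^+ 120 = 1.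
Proof.
move=> Dz.
have tz : t * z = z ^+ 2 + 1 by rewrite Dz; ring.
have z4 : z ^+ 4 = (t ^+ 2 - 2%:R) * z ^+ 2 - 1.
  transitivity ((t * z) ^+ 2 - 2%:R * z ^+ 2 - 1); last by ring.
  by rewrite tz; ring.
(* It is enough that z^k be 1 or -1 with 2k dividing 120: the even exponent absorbs the sign. *)
have sign_pow k n e : z ^+ k = (-1) ^+ e -> (k * n.*2 = 120)%N -> z ^+ 120 = 1.
  by move=> zk <-; rewrite exprM zk -exprM -mul2n mulnCA exprM sqrrN !expr1n.
case=> /eqP; rewrite !mulf_eq0 !subr_eq0 -?orbA; [case/or3P | case/or4P] => /eqP Dt.
- apply: (sign_pow 2%N 30%N 1%N) => //; rewrite Dz Dt; ring.
- apply: (sign_pow 6%N 10%N 0%N) => //; rewrite Dt in z4.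
  transitivity (- z ^+ 4 - z ^+ 2); last by rewrite z4; ring.
  by transitivity (z ^+ 4 * z ^+ 2); [ring | rewrite {1}z4; ring].
(* With t^2 = 4, [z4] reads (z^2 - 1)^2 = 0. *)
- apply: (sign_pow 2%N 30%N 0%N) => //; rewrite Dt in z4.
  apply/eqP; rewrite -subr_eq0 -sqrf_eq0; apply/eqP.
  by transitivity (z ^+ 4 - 2%:R * z ^+ 2 + 1); [ring | rewrite z4; ring].
- by apply: (sign_pow 4%N 15%N 1%N) => //; rewrite z4 Dt; ring.
- apply: (sign_pow 6%N 10%N 1%N) => //; rewrite Dt in z4.
  transitivity (z ^+ 4 - z ^+ 2); last by rewrite z4; ring.
  by transitivity (z ^+ 4 * z ^+ 2); [ring | rewrite {1}z4; ring].
(* Here [z4'] says that z is a root of the tenth cyclotomic polynomial, so z^5 = -1. *)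
- have Dt2 : t ^+ 2 = t + 1 by rewrite -Dt; ring.
  have z4' : z ^+ 4 = z ^+ 3 - z ^+ 2 + z - 1.
    rewrite z4 Dt2; transitivity (t * z * z - z ^+ 2 - 1); first by ring.
    by rewrite tz; ring.
  apply: (sign_pow 5%N 12%N 1%N) => //.
  transitivity (z ^+ 4 - z ^+ 3 + z ^+ 2 - z); last by rewrite z4'; ring.
  by transitivity (z ^+ 4 * z); [ring | rewrite {1}z4'; ring].
(* Here [z4'] is the fifth cyclotomic equation, so z^5 = 1. *)
- have Dt2 : t ^+ 2 = 1 - t by rewrite -Dt; ring.
  have z4' : z ^+ 4 = - z ^+ 3 - z ^+ 2 - z - 1.
    rewrite z4 Dt2; transitivity (- (t * z * z) - z ^+ 2 - 1); first by ring.
    by rewrite tz; ring.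
  apply: (sign_pow 5%N 12%N 0%N) => //.
  transitivity (- z ^+ 4 - z ^+ 3 - z ^+ 2 - z); last by rewrite z4'; ring.
  by transitivity (z ^+ 4 * z); [ring | rewrite {1}z4'; ring].
Qed.

Lemma rational_traceE (F : numFieldType) (a t : F) : a != 0 ->
  (2%:R^-1 * t * a \in [:: 0; a; - a; 1 / 2%:R * a; - (1 / 2%:R * a)]) =
  (rational_trace t == 0).
Proof.
move=> a0; have two0 : 2%:R != 0 :> F by rewrite pnatr_eq0.
have E x y : y = 2%:R^-1 * x * a -> (2%:R^-1 * t * a == y) = (t - x == 0).
  move=> ->; rewrite (inj_eq (mulIf a0)) (inj_eq (mulfI _)) ?invr_eq0 //.
  by rewrite subr_eq0.
have -> : rational_trace t = (t - 0) * (t - 2%:R) * (t + 2%:R) * (t - 1) * (t + 1).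
  by rewrite /rational_trace; ring.
rewrite !inE (E 0 0) ?(E 2%:R a) ?(E (- 2%:R) (- a)) ?(E 1 (1 / 2%:R * a))
  ?(E (- 1) (- (1 / 2%:R * a))); try by field.
by rewrite !mulf_eq0 -!orbA !opprK.
Qed.

Lemma quadratic_traceE (C : numClosedFieldType) (a t : C) : a != 0 ->
  (2%:R^-1 * t * a \in
     [:: sqrtC 2%:R / 2%:R * a; - (sqrtC 2%:R / 2%:R * a);
         sqrtC 3%:R / 2%:R * a; - (sqrtC 3%:R / 2%:R * a);
         (1 + sqrtC 5%:R) / 4%:R * a; (1 - sqrtC 5%:R) / 4%:R * a;
         (- 1 + sqrtC 5%:R) / 4%:R * a; (- 1 - sqrtC 5%:R) / 4%:R * a]) =
  (quadratic_trace t == 0).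
Proof.
move=> a0; have two0 : 2%:R != 0 :> C by rewrite pnatr_eq0.
have E x y : y = 2%:R^-1 * x * a -> (2%:R^-1 * t * a == y) = (t - x == 0).
  move=> ->; rewrite (inj_eq (mulIf a0)) (inj_eq (mulfI _)) ?invr_eq0 //.
  by rewrite subr_eq0.
have [s2 s3 s5] : [/\ sqrtC 2%:R ^+ 2 = 2%:R :> C, sqrtC 3%:R ^+ 2 = 3%:R :> C
    & sqrtC 5%:R ^+ 2 = 5%:R :> C] by rewrite !sqrtCK.
move: (sqrtC 2%:R) (sqrtC 3%:R) (sqrtC 5%:R) s2 s3 s5 => u v w u2 v2 w2.
(* Taking e = 1 and e = -1 factors both golden quadratics, of discriminant e^2 + 4 = 5. *)
have golden e : e ^+ 2 = 1 ->
    t ^+ 2 - e * t - 1 = (t - (e + w) / 2%:R) * (t - (e - w) / 2%:R).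
  move=> e2; transitivity (t ^+ 2 - e * t + (e ^+ 2 - w ^+ 2) / 4%:R); last by field.
  by rewrite e2 w2; field.
have -> : quadratic_trace t = (t - u) * (t + u) * ((t - v) * (t + v)) *
    ((t - (1 + w) / 2%:R) * (t - (1 - w) / 2%:R)) *
    ((t - (- 1 + w) / 2%:R) * (t - (- 1 - w) / 2%:R)).
  rewrite -!golden ?sqrrN ?expr1n // -!subr_sqr u2 v2 /quadratic_trace.
  by rewrite mulN1r mul1r opprK.
rewrite !inE (E u (u / 2%:R * a)) ?(E (- u) (- (u / 2%:R * a))) ?(E v (v / 2%:R * a))
  ?(E (- v) (- (v / 2%:R * a))) ?(E ((1 + w) / 2%:R) ((1 + w) / 4%:R * a))
  ?(E ((1 - w) / 2%:R) ((1 - w) / 4%:R * a))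
  ?(E ((- 1 + w) / 2%:R) ((- 1 + w) / 4%:R * a))
  ?(E ((- 1 - w) / 2%:R) ((- 1 - w) / 4%:R * a)); try by field.
by rewrite !mulf_eq0 -!orbA !opprK.
Qed.

(** * Powers of a matrix and its eigenvalues *)

(** The recurrence says that (U - z)(U - (t - z)) kills [w], where t - z = 1/z. Either [w] is an
    eigenvector for 1/z, or [w *m U - (t - z) *: w] is one for z; both cases give z^k = 1, even when
    z = 1/z. *)
Lemma recurrence_unit_root (C : numClosedFieldType) (n k : nat) (U : 'M[C]_n)
    (w : 'rV[C]_n) (t z : C) :
    w != 0 -> w *m U *m U = t *: (w *m U) - w -> U ^+ k = 1%:M ->
    z ^+ 2 = t * z - 1 -> z ^+ k = 1.
Proof.
move=> w0 wUU Uk Dz.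
have z_inv : z * (t - z) = 1 by rewrite mulrBr -expr2 Dz; ring.
have eig (y : 'rV[C]_n) u : y != 0 -> y *m U = u *: y -> u ^+ k = 1.
  move=> y0 yU; have yUk j : y *m U ^+ j = u ^+ j *: y.
    elim: j => [|j IHj]; first by rewrite !expr0 mulmx1 scale1r.
    by rewrite exprSr mulmxA IHj -scalemxAl yU scalerA -exprSr.
  apply/eqP; rewrite -subr_eq0; have /eqP := yUk k.
  by rewrite Uk mulmx1 -subr_eq0 -{1}[y]scale1r -scalerBl scaler_eq0 (negPf y0) orbF
    -opprB oppr_eq0.
have [wU|y0] := eqVneq (w *m U) ((t - z) *: w).
  by have := congr1 (fun x => x ^+ k) z_inv; rewrite exprMn (eig w _ w0 wU) mulr1 expr1n.
apply: (eig (w *m U - (t - z) *: w)); first by rewrite subr_eq0.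
rewrite mulmxBl wUU -scalemxAl scalerBr scalerA z_inv scale1r scalerBl.
by rewrite opprB addrC addrA subrK.
Qed.

(** A normal matrix is unitarily diagonalizable; the rows of [X] are eigenvectors for the diagonal
    entries, so the k-th power of the diagonal part is the identity. *)
Lemma normal_periodic (C : numClosedFieldType) (n k : nat) (U : 'M[C]_n) :
    U \is normalmx ->
    (forall (z : C) (v : 'rV[C]_n), v != 0 -> v *m U = z *: v -> z ^+ k = 1) ->
  U ^+ k = 1%:M.
Proof.
move=> /orthomx_spectralP; set X := spectralmx U; set D := spectral_diag U => DU eig.
have X_unit : X \in unitmx by apply: spectral_unit.
have Dk i : D 0 i ^+ k = 1.
  apply: (eig _ (row i X)).
    apply: contraTneq X_unit => rowX; rewrite -row_free_unit; apply/row_freePn.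
    by exists i; rewrite rowX sub0mx.
  rewrite -row_mul {1}DU !mulmxA mulmxV // mul1mx; apply/rowP=> j.
  by rewrite mul_diag_mx !mxE.
have -> : U ^+ k = invmx X *m diag_mx (\row_i D 0 i ^+ k) *m X.
  elim: k {eig Dk} => [|k IHk].
    rewrite expr0 (_ : \row_i _ = const_mx 1) ?diag_const_mx ?mulmx1 ?mulVmx //.
    by apply/rowP=> i; rewrite !mxE expr0.
  rewrite exprSr IHk -[_ * U]/(_ *m U) [in LHS]DU !mulmxA mulmxK // -!mulmxA; congr (_ *m _).
  rewrite !mulmxA; congr (_ *m _); rewrite mulmx_diag; congr diag_mx.
  by apply/rowP=> i; rewrite !mxE exprSr.
rewrite (_ : \row_i _ = const_mx 1) ?diag_const_mx ?mulmx1 ?mulVmx //.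
by apply/rowP=> i; rewrite !mxE Dk.
Qed.

(** * Spectral correspondence between a product of two reflections and [A] *)

Section GroverWalk.
Variables (C : numClosedFieldType) (n p : nat) (d : C).
Variables (R : 'M[C]_n) (D : 'M[C]_(n, p)) (A : 'M[C]_p).
Hypotheses (d0 : d != 0) (RR : R *m R = 1%:M) (DD : D^T *m D = d%:M).
Hypothesis DRD : D^T *m R *m D = A.

(** By [DD] the matrix D D^T / d is idempotent, so [S] is the reflection fixing the row space of
    [D^T]. *)
Let S := 2%:R *: (d^-1 *: (D *m D^T)) - 1%:M.

Lemma coinK m (v : 'M[C]_(m, p)) : v *m D^T *m S = v *m D^T.
Proof.
rewrite mulmxBr mulmx1 -!scalemxAr !mulmxA -(mulmxA v) DD.
rewrite mul_mx_scalar -scalemxAl scalerK // scaler_nat mulr2n.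
by rewrite addrK.
Qed.

Lemma coin_mulr : S *m D = D.
Proof.
rewrite mulmxBl mul1mx -!scalemxAl -mulmxA DD mul_mx_scalar scalerK //.
by rewrite scaler_nat mulr2n addrK.
Qed.

Lemma coin_invol : S *m S = 1%:M.
Proof.
rewrite {2}/S mulmxBr mulmx1 -!scalemxAr mulmxA coin_mulr opprB addrCA.
by rewrite subrr addr0.
Qed.

(** The walk maps [w] to [v *m D^T], because [R] is an involution and [S] fixes that vector; it then
    maps [v *m D^T] back into the span of the two, [DRD] producing the coefficient 2 lam / d. *)
Lemma walk_recurrence (lam : C) (v : 'rV[C]_p) : v *m A = lam *: v ->
  let w := v *m D^T *m R in
  w *m (R *m S) *m (R *m S) = (2%:R * lam / d) *: (w *m (R *m S)) - w.
Proof.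
move=> vA w; have wU : w *m (R *m S) = v *m D^T.
  by rewrite /w !mulmxA -(mulmxA _ R R) RR mulmx1 coinK.
rewrite wU mulmxA -/w mulmxBr mulmx1 -!scalemxAr; congr (_ - _).
rewrite /w !mulmxA -(mulmxA v) -(mulmxA v) DRD vA -scalemxAl !scalerA.
by congr (_ *: _); rewrite mulrAC -mulrA.
Qed.

(** The candidate eigenvector of [A] is [v *m D]. If it vanishes, then [S] negates [v] and two steps
    of the walk fix it, so z^2 = 1. *)
Lemma walk_eigenvalue (z : C) (v : 'rV[C]_n) : v != 0 -> v *m (R *m S) = z *: v ->
  z ^+ 2 = 1 \/ (z != 0 /\ eigenvalue A (2%:R^-1 * (z + z^-1) * d)).
Proof.
move=> v0 vU.
have vR : v *m R = z *: (v *m S).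
  by rewrite scalemxAl -vU -!mulmxA coin_invol mulmx1.
have vE : v = z *: (v *m S *m R) by rewrite scalemxAl -vR -mulmxA RR mulmx1.
have z0 : z != 0 by apply: contraNneq v0 => z0; rewrite vE z0 scale0r.
have vRD : v *m R *m D = z *: (v *m D) by rewrite vR -scalemxAl -mulmxA coin_mulr.
have [vD|vD] := eqVneq (v *m D) 0; [left | right; split=> //].
  have vS : v *m S = - v.
    by rewrite mulmxBr mulmx1 -!scalemxAr mulmxA vD mul0mx !scaler0 sub0r.
  have /eqP : v = z ^+ 2 *: v.
    by rewrite {1}vE vS mulNmx vR vS !scalerN opprK scalerA -expr2.
  rewrite -subr_eq0 -{1}[v]scale1r -scalerBl scaler_eq0 (negPf v0) orbF subr_eq0.
  by move/eqP.
apply/eigenvalueP; exists (v *m D) => //.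
(* Apply [D] to [vE] and expand [S]: the projection part yields [A] through [DRD], the rest is
   [vRD]. *)
have : v *m D = z *: ((2%:R / d) *: (v *m D *m A) - z *: (v *m D)).
  rewrite {1}vE -scalemxAl; congr (_ *: _).
  rewrite mulmxBr mulmx1 !mulmxBl vRD; congr (_ - _).
  by rewrite -!scalemxAr -!scalemxAl scalerA -DRD !mulmxA.
set x := v *m D => Dx.
have /(congr1 (fun y => (2%:R^-1 * d) *: y)) : (2%:R / d) *: (x *m A) = (z + z^-1) *: x.
  rewrite scalerDl {3}Dx scalerA mulVf // scale1r addrC subrK //.
rewrite !scalerA; have -> : 2%:R^-1 * d * (2%:R / d) = 1.
  by field.
by rewrite scale1r => ->; congr (_ *: _); ring.
Qed.

End GroverWalk.

(** * Projections onto the vectors constant on cells *)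

Lemma sum_enum_val (V : nmodType) (T : finType) (F : T -> V) :
  \sum_(i < #|T|) F (enum_val i) = \sum_x F x.
Proof. by rewrite -(big_enum_val (A := T)). Qed.

Lemma end_partition_cellP (H : sgraph) (B : {set H}) (e f : {set H}) :
    e \in edges H -> f \in edges H ->
  e :&: B = f :&: B <-> exists2 A, A \in end_partition B & (e \in A) && (f \in A).
Proof.
move=> eE fE; have /and3P[/eqP cov triv _] := end_partitionP B.
have same g h : g \in edges H -> h \in edges H ->
    (h \in pblock (end_partition B) g) = (g :&: B == h :&: B).
  move=> gE hE; rewrite [LHS]pblock_equivalence_partition // => x y z _ _ _.
  by split=> //= /eqP->.
split=> [ef|[A PA /andP[eA fA]]].
  exists (pblock (end_partition B) e); first by rewrite pblock_mem ?cov.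
  by rewrite !same // ef eqxx.
by apply/eqP; rewrite -same // (def_pblock triv PA eA).
Qed.

(** [K] is the same-cell matrix, and [K *m K = c *: K] says that every cell has size [c]; hence [K]
    divided by [c] averages over cells, which is the orthogonal projection. *)
Lemma const_projE (C : numClosedFieldType) (H : sgraph) (B : {set H}) (c : C)
    (K : 'M[C]_#|edges H|) :
    c != 0 -> K *m K = c *: K ->
    (forall e f, K e f = (enum_val e :&: B == enum_val f :&: B)%:R) ->
  const_proj C (edges H) (end_partition B) = c^-1 *: K.
Proof.
move=> c0 KK KE; set M := cell_mx C (edges H) (end_partition B).
have Ksym : K^T = K by apply/matrixP => e f; rewrite !mxE !KE eq_sym.
have KM : (K <= M)%MS.
  apply/row_subP => e; apply/(cell_mxP _ (end_partitionP B)) => A PA f g fA gA.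
  rewrite !mxE !KE (_ : enum_val f :&: B = enum_val g :&: B) //.
  by apply/(end_partition_cellP B (enum_valP f) (enum_valP g)); exists A; rewrite ?fA.
(* Since [K] is a symmetric 0/1 matrix, the diagonal entries of [K *m K] are its column sums. *)
have rowK f : \sum_e K e f = c.
  have := congr1 (fun X : 'M_#|edges H| => X f f) KK; rewrite !mxE KE eqxx mulr1 => <-.
  apply: eq_bigr => e _; rewrite !KE (eq_sym (enum_val f :&: B)).
  by case: (_ == _); rewrite ?mulr1 ?mulr0.
have MK : M *m K = c *: M.
  apply/row_matrixP => k; rewrite row_mul linearZ /=.
  move: (row k M) (row_sub k M) => v /(cell_mxP _ (end_partitionP B)) v_const.
  apply/rowP => f; rewrite !mxE -(rowK f) mulr_suml; apply: eq_bigr => e _.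
  rewrite KE; case: eqP => [same_end|]; last by rewrite mulr0 mul0r.
  have [A PA /andP[eA fA]] :=
    (end_partition_cellP B (enum_valP e) (enum_valP f)).1 same_end.
  by rewrite mulr1 mul1r (v_const A PA e f).
rewrite /const_proj -/M -[RHS]trmxK linearZ /= Ksym; congr (_^T).
(* Split the identity as K/c plus 1 - K/c: the projection fixes the rows of the first term, which
   lie in the row space of [M], and kills those of the second, which are orthogonal to it. *)
have KP : (c^-1 *: K) *m proj_ortho M = c^-1 *: K.
  by apply: proj_ortho_id; apply: submx_trans KM; apply: scalemx_sub.
suff K0 : (1%:M - c^-1 *: K) *m proj_ortho M = 0.
  by rewrite -[LHS]mul1mx -[1%:M](subrK (c^-1 *: K)) mulmxDl K0 add0r KP.
apply: proj_ortho_0; apply/orthomx1P.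
have -> : (M^T ^ Num.conj)%sesqui = M^T by apply/matrixP => e f; rewrite !mxE rmorph_nat.
rewrite mulmxBl mul1mx -scalemxAl -{1}Ksym -trmx_mul MK [(c *: M)^T]linearZ /= scalerK //.
exact: subrr.
Qed.

(** * Incidence matrices of the subdivision graph *)

Section SubdivisionIncidence.
Variables (C : numClosedFieldType) (G : sgraph).

Let E : finType := {f : {set G} | f \in edges G}.

Lemma edgesP (f : {set G}) x y : f \in edges G -> x \in f -> y \in f -> x != y ->
  f = [set x; y] /\ adj x y.
Proof.
move=> /imsetP[[u v] uv ->]; rewrite inE /= in uv.
rewrite !inE => /orP[]/eqP-> /orP[]/eqP->; rewrite ?eqxx // => _.
by rewrite setUC adj_sym.
Qed.

Lemma card_edge (f : {set G}) : f \in edges G -> #|f| = 2%N.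
Proof.
move=> /imsetP[[u v] /= uv ->]; rewrite cards2; case: eqVneq uv => // ->.
by rewrite inE /= adj_irr.
Qed.

(** Sending a neighbour y of x to the edge {x, y} is a bijection, injective because G has no
    loops. *)
Lemma card_incident (x : G) : #|[set f in edges G | x \in f]| = #|[set y | adj x y]|.
Proof.
have -> : [set f in edges G | x \in f] = [set [set x; y] | y in [set y | adj x y]].
  apply/setP => f; rewrite inE; apply/andP/imsetP => [[fE xf]|[y]]; last first.
    rewrite inE => xy ->; split; last by rewrite !inE eqxx.
    by apply/imsetP; exists (x, y); rewrite ?inE.
  case/imsetP: fE xf => -[u v] uv ->; rewrite inE /= in uv.
  rewrite !inE => /orP[]/eqP Dx; first by exists v; rewrite ?inE Dx.
  by exists u; rewrite ?inE Dx; [rewrite adj_sym | rewrite setUC].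
rewrite card_in_imset // => y z; rewrite !inE => xy xz /setP/(_ y).
rewrite !inE eqxx orbT => /esym/orP[]/eqP // Dy.
by rewrite Dy adj_irr in xy.
Qed.

Lemma sum_edges_mem (P : pred {set G}) :
  \sum_(f : E) (P (val f))%:R = #|[set f in edges G | P f]|%:R :> C.
Proof.
rewrite -(big_sub (mem (edges G)) (fun f => (P f)%:R)) -natr_sum -sum1dep_card big_mkcondr.
by congr (_%:R); apply: eq_bigr => f _; case: (P f).
Qed.

(** When x is an end of f, this is an edge of S(G), and all its edges arise so; sums over edges thus
    become sums over incident pairs. *)
Definition flag (x : G) (f : E) : {set subdiv G} := [set inl x; inr f].

Lemma inl_flag x y f : ((inl x : subdiv G) \in flag y f) = (x == y).
Proof. by rewrite !inE orbF. Qed.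

Lemma inr_flag f y g : ((inr f : subdiv G) \in flag y g) = (f == g).
Proof. by rewrite !inE. Qed.

Lemma flag_inj x y (f g : E) : flag x f = flag y g -> (x, f) = (y, g).
Proof.
move=> eq_fl; have := inl_flag x y g; have := inr_flag f y g.
by rewrite -eq_fl inl_flag inr_flag !eqxx => /esym/eqP-> /esym/eqP->.
Qed.

Lemma flagP (e : {set subdiv G}) :
  reflect (exists x (f : E), x \in val f /\ e = flag x f) (e \in edges (subdiv G)).
Proof.
apply: (iffP imsetP) => [[[[x|f] [y|g]]]|[x [f [xf ->]]]]; rewrite ?inE //.
- by move=> xg ->; exists x, g.
- by move=> yf ->; exists y, f; split=> //; rewrite /flag setUC.
- by exists (inl x, inr f); rewrite ?inE.
Qed.

Lemma sum_flags (F : {set subdiv G} -> C) :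
  \sum_(i < #|edges (subdiv G)|) F (enum_val i) =
  \sum_x \sum_(f : E | x \in val f) F (flag x f).
Proof.
rewrite -(big_enum_val (A := mem (edges (subdiv G)))) pair_big_dep /=.
have -> : \sum_(e in edges (subdiv G)) F e =
    \sum_(e in [set flag p.1 p.2 | p in [set p : G * E | p.1 \in val p.2]]) F e.
  apply: eq_bigl => e; apply/flagP/imsetP => [[x [f [xf ->]]]|[[x f]]].
    by exists (x, f); rewrite ?inE.
  by rewrite inE => xf ->; exists x, f.
rewrite big_imset => [|[x f] [y g] _ _ /flag_inj //].
by apply: eq_bigl => p; rewrite inE.
Qed.

Definition vertex_incidence : 'M[C]_(#|edges (subdiv G)|, #|G|) :=
  \matrix_(e < #|edges (subdiv G)|, x < #|G|) ((inl (enum_val x) : subdiv G) \in enum_val e)%:R.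

Definition edge_incidence : 'M[C]_(#|edges (subdiv G)|, #|E|) :=
  \matrix_(e < #|edges (subdiv G)|, f < #|E|) ((inr (enum_val f) : subdiv G) \in enum_val e)%:R.

Local Notation D := vertex_incidence.
Local Notation D0 := edge_incidence.

(** Each edge of S(G) has a single end in V(G), so distinct columns are orthogonal; the diagonal
    counts the edges of G at a vertex. *)
Lemma vertex_incidence_gram d : regular G d -> D^T *m D = d%:R%:M.
Proof.
move=> regG; apply/matrixP => i j; rewrite !mxE.
under eq_bigr do rewrite !mxE.
rewrite (sum_flags (fun e => (_ \in e)%:R * (_ \in e)%:R)) (bigD1 (enum_val i)) //=.
rewrite [X in _ + X]big1 ?addr0 => [|x xi]; last first.
  by rewrite big1 // => f _; rewrite inl_flag eq_sym (negPf xi) mul0r.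
under eq_bigr do rewrite !inl_flag eqxx mul1r.
rewrite big_mkcond (eq_bigr (fun f : E =>
    (j == i)%:R * (enum_val i \in val f)%:R)) => [|f _]; last first.
  by rewrite (inj_eq enum_val_inj) /=; case: ifP; rewrite ?mulr1 ?mulr0.
rewrite -mulr_sumr (sum_edges_mem (fun f => enum_val i \in f)) card_incident regG.
by rewrite eq_sym mulr_natl.
Qed.

Lemma edge_incidence_gram : D0^T *m D0 = 2%:R%:M.
Proof.
apply/matrixP => i j; rewrite !mxE.
under eq_bigr do rewrite !mxE.
rewrite (sum_flags (fun e => (_ \in e)%:R * (_ \in e)%:R)).
rewrite (exchange_big_dep xpredT) //= (bigD1 (enum_val i)) //=.
rewrite [X in _ + X]big1 ?addr0 => [|f fi]; last first.
  by rewrite big1 // => x _; rewrite inr_flag eq_sym (negPf fi) mul0r.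
under eq_bigr do rewrite !inr_flag eqxx mul1r.
rewrite (inj_eq enum_val_inj) sumr_const card_edge ?(valP (enum_val i)) //.
by rewrite eq_sym; case: (i == j); rewrite ?mul0rn.
Qed.

(** Only the flag of the two indices can contribute, so the product is the vertex-edge incidence
    matrix of G. *)
Lemma incidence_mul i j : (D^T *m D0) i j = (enum_val i \in val (enum_val j : E))%:R.
Proof.
rewrite !mxE.
under eq_bigr do rewrite !mxE.
rewrite (sum_flags (fun e => (_ \in e)%:R * (_ \in e)%:R)) (bigD1 (enum_val i)) //=.
rewrite [X in _ + X]big1 ?addr0 => [|x xi]; last first.
  by rewrite big1 // => f _; rewrite inl_flag eq_sym (negPf xi) mul0r.
under eq_bigr do rewrite inl_flag inr_flag eqxx mul1r.
rewrite big_mkcond (bigD1 (enum_val j)) //= eqxx big1 ?addr0; first by case: ifP.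
by move=> f fj; rewrite eq_sym (negPf fj); case: ifP.
Qed.

(** With N = D^T D0 the incidence matrix of G, N N^T counts the edges containing two given vertices,
    so it equals A + d; the subtracted D^T D is d. *)
Lemma adjmx_incidence d : regular G d ->
  D^T *m (D0 *m D0^T - 1%:M) *m D = adjmx C G.
Proof.
move=> regG; rewrite mulmxBr mulmxBl mulmx1 (vertex_incidence_gram regG).
rewrite mulmxA -mulmxA -[D0^T *m D]trmxK trmx_mul trmxK.
apply/matrixP => i j; rewrite 3!mxE.
under eq_bigr do rewrite incidence_mul mxE incidence_mul -natrM mulnb.
rewrite (sum_enum_val (fun f : E => ((enum_val i \in val f) && (enum_val j \in val f))%:R)).
rewrite (sum_edges_mem (fun f => (enum_val i \in f) && (enum_val j \in f))) !mxE.
have [->|ij] := eqVneq i j.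
  rewrite adj_irr; under eq_finset do rewrite andbb.
  by rewrite card_incident regG subrr.
rewrite subr0; case: (boolP (adj _ _)) => [xy|not_xy].
  rewrite (_ : [set f in _ | _] = [set [set enum_val i; enum_val j]]) ?cards1 //.
  apply/setP => f; rewrite !inE; apply/and3P/eqP => [[fE xf yf]|->].
    by have [|->] := edgesP fE xf yf; rewrite ?(inj_eq enum_val_inj).
  split; rewrite ?inE ?eqxx ?orbT //.
  by apply/imsetP; exists (enum_val i, enum_val j); rewrite ?inE.
rewrite (_ : [set f in _ | _] = set0) ?cards0 //.
apply/setP => f; rewrite !inE; apply/and3P => -[fE xf yf].
by have [|_] := edgesP fE xf yf; rewrite ?(inj_eq enum_val_inj) ?(negPf not_xy).
Qed.

(** This and its analogue for [edge_incidence] supply the same-cell matrices required by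
    [const_projE]. *)
Lemma vertex_incidence_outer e f :
  (D *m D^T) e f = (enum_val e :&: subdiv_C1 G == enum_val f :&: subdiv_C1 G)%:R.
Proof.
have /flagP[x [g [_ De]]] := enum_valP e; have /flagP[y [h [_ Df]]] := enum_valP f.
rewrite !mxE; under eq_bigr do rewrite !mxE De Df !inl_flag -natrM mulnb.
rewrite (sum_enum_val (fun z : G => ((z == x) && (z == y))%:R)).
rewrite (bigD1 x) //= eqxx big1 ?addr0 /= => [|z /negPf-> //].
have C1 z k : flag z k :&: subdiv_C1 G = [set inl z].
  by apply/setP => -[u|u]; rewrite !inE ?andbT ?andbF ?orbF.
by rewrite De Df !C1 (inj_eq set1_inj).
Qed.

Lemma edge_incidence_outer e f :
  (D0 *m D0^T) e f = (enum_val e :&: subdiv_C0 G == enum_val f :&: subdiv_C0 G)%:R.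
Proof.
have /flagP[x [g [_ De]]] := enum_valP e; have /flagP[y [h [_ Df]]] := enum_valP f.
rewrite !mxE; under eq_bigr do rewrite !mxE De Df !inr_flag -natrM mulnb.
rewrite (sum_enum_val (fun z : E => ((z == g) && (z == h))%:R)).
rewrite (bigD1 g) //= eqxx big1 ?addr0 /= => [|z /negPf-> //].
have C0 z k : flag z k :&: subdiv_C0 G = [set inr k].
  by apply/setP => -[u|u]; rewrite !inE ?andbT ?andbF ?orbF.
by rewrite De Df !C0 (inj_eq set1_inj).
Qed.

End SubdivisionIncidence.

(** * Hermitian reflections and normality of their product *)

(** The adjoint of R S is S R, and both products of the two collapse to the identity. *)
Lemma mul_invol_hermitian_normal (C : numClosedFieldType) (n : nat) (R S : 'M[C]_n) :
    R *m R = 1%:M -> S *m S = 1%:M ->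
    (R^T ^ Num.conj)%sesqui = R -> (S^T ^ Num.conj)%sesqui = S ->
  R *m S \is normalmx.
Proof.
move=> RR SS Rh Sh; apply/normalmxP.
rewrite trmx_mul map_mxM Rh Sh !mulmxA -(mulmxA R) SS mulmx1 RR.
by rewrite -(mulmxA S R) RR mulmx1 SS.
Qed.

Lemma reflection_hermitian (C : numClosedFieldType) (n : nat) (c : C) (K : 'M[C]_n) :
    c \is Num.real -> (K^T ^ Num.conj)%sesqui = K ->
  ((2%:R *: (c *: K) - 1%:M)^T ^ Num.conj)%sesqui = 2%:R *: (c *: K) - 1%:M.
Proof.
move=> c_real Kh; have Kc i j : (K j i)^* = K i j by rewrite -[in RHS]Kh !mxE.
apply/matrixP => i j; rewrite !mxE rmorphB /= !rmorphM /= Kc !rmorph_nat.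
by rewrite (conj_Creal c_real) eq_sym.
Qed.

Lemma outer_hermitian (C : numClosedFieldType) (n p : nat) (D : 'M[C]_(n, p)) :
  (D ^ Num.conj)%sesqui = D -> ((D *m D^T)^T ^ Num.conj)%sesqui = D *m D^T.
Proof. by move=> Dreal; rewrite trmx_mul trmxK map_mxM -map_trmx Dreal. Qed.

Lemma outer_mul_idem (F : fieldType) (n p : nat) (D : 'M[F]_(n, p)) (c : F) :
  D^T *m D = c%:M -> D *m D^T *m (D *m D^T) = c *: (D *m D^T).
Proof. by move=> DD; rewrite mulmxA -(mulmxA D) DD mul_mx_scalar -scalemxAl. Qed.

(** * Periodicity of the walk over S(G) in terms of the eigenvalues of G *)

Section SubdivisionWalk.
Variables (C : numClosedFieldType) (G : sgraph) (d : nat).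
Hypotheses (d_gt0 : (1 <= d)%N) (regG : regular G d).

Local Notation D := (vertex_incidence C G).
Local Notation D0 := (edge_incidence C G).
Local Notation A := (adjmx C G).
Local Notation U := (bipartite_walk C (subdiv_C0 G) (subdiv_C1 G)).

Let R := 2%:R *: (2%:R^-1 *: (D0 *m D0^T)) - 1%:M.
Let S := 2%:R *: (d%:R^-1 *: (D *m D^T)) - 1%:M.

Let d0 : d%:R != 0 :> C.
Proof. by rewrite pnatr_eq0 -lt0n. Qed.

Let two0 : 2%:R != 0 :> C.
Proof. by rewrite pnatr_eq0. Qed.

Let DD := vertex_incidence_gram C regG.
Let DD0 := edge_incidence_gram C G.

Lemma subdiv_walkE : U = R *m S.
Proof.
rewrite /bipartite_walk (const_projE two0 (outer_mul_idem DD0)); last exact: edge_incidence_outer.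
by rewrite (const_projE d0 (outer_mul_idem DD)) //; exact: vertex_incidence_outer.
Qed.

(** [R] has the form of [S], with [D0] and 2 in place of [D] and [d]. *)
Let RR : R *m R = 1%:M. Proof. exact: coin_invol. Qed.

Let DRD : D^T *m R *m D = A.
Proof. by rewrite /R scalerA divff // scale1r; exact: adjmx_incidence regG. Qed.

Lemma subdiv_walk_normal : U \is normalmx.
Proof.
rewrite subdiv_walkE; apply: mul_invol_hermitian_normal => //.
- exact: coin_invol.
- apply: reflection_hermitian; first by rewrite realV realn.
  by apply: outer_hermitian; apply/matrixP => i j; rewrite !mxE rmorph_nat.
- apply: reflection_hermitian; first by rewrite realV realn.
  by apply: outer_hermitian; apply/matrixP => i j; rewrite !mxE rmorph_nat.
Qed.

(** An eigenvector of [A] lifts to a vector satisfying the walk recurrence, so t is z + 1/z for a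
    root of unity z. *)
Lemma subdiv_periodic_trace (lam : C) : periodic U -> eigenvalue A lam ->
  let t := 2%:R * lam / d%:R in
  [/\ integralOver (intr : int -> C) t, t \is Num.real & -2%:R <= t <= 2%:R].
Proof.
case=> k k_gt0 Uk /eigenvalueP[v vA v0] t.
(* Applying [R] and then [D] to the lift gives back d v. *)
have w0 : v *m D^T *m R != 0.
  apply: contraNneq v0 => w0; have := congr1 (fun x => x *m R *m D) w0.
  rewrite -(mulmxA _ R R) RR mulmx1 -(mulmxA v) DD !mul0mx mul_mx_scalar => /eqP.
  by rewrite scaler_eq0 (negPf d0).
have := walk_recurrence d0 RR DD DRD vA; rewrite -/S -subdiv_walkE -/t => wUU.
(* A root of X^2 - t X + 1, by the quadratic formula; the other root is t - z. *)
pose z : C := (t + sqrtC (t ^+ 2 - 4%:R)) / 2%:R.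
have Dz : z ^+ 2 = t * z - 1.
  have s2 : sqrtC (t ^+ 2 - 4%:R) ^+ 2 = t ^+ 2 - 4%:R by rewrite sqrtCK.
  rewrite /z; apply/eqP; rewrite -subr_eq0; apply/eqP.
  transitivity ((sqrtC (t ^+ 2 - 4%:R) ^+ 2 - (t ^+ 2 - 4%:R)) / 4%:R); first by field.
  by rewrite s2 subrr mul0r.
have zk := recurrence_unit_root w0 wUU Uk Dz.
have zw : z * (t - z) = 1 by rewrite mulrBr -expr2 Dz; ring.
by have := unit_root_trace k_gt0 zk zw; rewrite addrC subrK.
Qed.

Lemma subdiv_trace_periodic :
    (forall t : C, eigenvalue A (2%:R^-1 * t * d%:R) ->
       rational_trace t = 0 \/ quadratic_trace t = 0) ->
  periodic U.
Proof.
move=> traces; exists 120%N => //; apply: normal_periodic; first exact: subdiv_walk_normal.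
move=> z v v0; rewrite subdiv_walkE => /(walk_eigenvalue d0 RR DD DRD v0)[z2|[z0]].
  by rewrite -[120%N]/(2 * 60)%N exprM z2 expr1n.
move=> /traces; apply: trace_unit_root.
by rewrite mulrDl mulVf // addrK expr2.
Qed.

End SubdivisionWalk.

(** * Conjugate eigenvalues and the final equivalence *)

(** The characteristic polynomial is rational because [A] has 0/1 entries, and the two numbers are
    the irrational roots of the rational quadratic [q]. *)
Lemma adjmx_conj_mup (C : numClosedFieldType) (G : sgraph) (x y : rat) (s : C) (m : int) :
    s ^+ 2 = m%:~R -> (forall r : rat, s != ratr r) -> y != 0 ->
  mup (ratr x - ratr y * s) (char_poly (adjmx C G)) =
  mup (ratr x + ratr y * s) (char_poly (adjmx C G)).
Proof.
move=> s2 s_irr y0; have y0C : ratr y != 0 :> C by rewrite fmorph_eq0.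
have irr (u v r : rat) : v != 0 -> ratr u + ratr v * s != ratr r.
  move=> v0; apply: contra_neq (s_irr ((r - u) / v)) => eq_r.
  have v0C : ratr v != 0 :> C by rewrite fmorph_eq0.
  by rewrite fmorph_div rmorphB /= -eq_r addrC addKr mulrC mulKf.
pose A : 'M[rat]_#|G| := \matrix_(i, j) (adj (enum_val i) (enum_val j))%:R.
have -> : char_poly (adjmx C G) = map_poly ratr (char_poly A).
  rewrite map_char_poly; congr char_poly; apply/matrixP => i j.
  by rewrite !mxE rmorph_nat.
pose q : {poly rat} := 'X^2 - (2%:R * x)%:P * 'X + (x ^+ 2 - y ^+ 2 * m%:~R)%:P.
apply: (@mup_conj_quadratic _ _ _ q).
- rewrite rmorphD /= rmorphB /= !rmorphM /= map_polyX !map_polyC /=.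
  rewrite [ratr (x ^+ 2 - _)]rmorphB /= [ratr (y ^+ 2 * _)]rmorphM /=.
  rewrite !rmorphXn /= ratr_int ratr_nat -s2; ring.
- by move=> r; rewrite -mulNr -rmorphN irr ?oppr_eq0.
- by move=> r; apply: irr.
- rewrite (inj_eq (addrI _)) -subr_eq0 -opprD oppr_eq0 -mulr2n mulrn_eq0 mulf_eq0.
  by rewrite (negPf y0C) -(rmorph0 (ratr : rat -> C)) (negPf (s_irr 0)).
- by rewrite monic_neq0 // char_poly_monic.
Qed.

Theorem corollary8p2 (C : numClosedFieldType) (G : sgraph) (d : nat)
    (a b : C -> rat) (m : C -> int) :
  (1 <= d)%N ->
  regular G d ->
  (forall lam : C, eigenvalue (adjmx C G) lam ->
     [/\ algint_deg_le 2 lam,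
         lam = ratr (a lam) + ratr (b lam) * sqrtC (m lam)%:~R,
         squarefree (m lam) & m lam != 1]) ->
  (periodic (bipartite_walk C (subdiv_C0 G) (subdiv_C1 G)) <->
   (forall lam : C, eigenvalue (adjmx C G) lam ->
      (b lam = 0 ->
         lam \in [:: 0; d%:R; - d%:R; 1 / 2%:R * d%:R; - (1 / 2%:R * d%:R)]) /\
      (b lam != 0 ->
         lam \in [:: sqrtC 2%:R / 2%:R * d%:R; - (sqrtC 2%:R / 2%:R * d%:R);
                     sqrtC 3%:R / 2%:R * d%:R; - (sqrtC 3%:R / 2%:R * d%:R);
                     (1 + sqrtC 5%:R) / 4%:R * d%:R;
                     (1 - sqrtC 5%:R) / 4%:R * d%:R;
                     (- 1 + sqrtC 5%:R) / 4%:R * d%:R;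
                     (- 1 - sqrtC 5%:R) / 4%:R * d%:R])))
  /\
  (forall lam : C, eigenvalue (adjmx C G) lam ->
     let lam' := ratr (a lam) - ratr (b lam) * sqrtC (m lam)%:~R in
     eigenvalue (adjmx C G) lam' /\
     mup lam' (char_poly (adjmx C G)) = mup lam (char_poly (adjmx C G))).
Proof.
move=> d_gt0 regG eigG.
have d0 : d%:R != 0 :> C by rewrite pnatr_eq0 -lt0n.
have sq_irr lam : eigenvalue (adjmx C G) lam ->
    forall r : rat, sqrtC (m lam)%:~R != ratr r :> C.
  by move=> /eigG[_ _ m_sqf m1] r; apply: sqrtC_squarefree_irrational.
have conj_mup lam : eigenvalue (adjmx C G) lam ->
    mup (ratr (a lam) - ratr (b lam) * sqrtC (m lam)%:~R) (char_poly (adjmx C G)) =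
    mup lam (char_poly (adjmx C G)).
  move=> lamG; have [_ Dlam _ _] := eigG _ lamG.
  have [b0|b0] := eqVneq (b lam) 0.
    by rewrite [in RHS]Dlam b0 rmorph0 mul0r subr0 addr0.
  by rewrite (adjmx_conj_mup _ _ (sqrtCK _) (sq_irr _ lamG) b0) -Dlam.
have conj_eig lam : eigenvalue (adjmx C G) lam ->
    eigenvalue (adjmx C G) (ratr (a lam) - ratr (b lam) * sqrtC (m lam)%:~R).
  (* Being an eigenvalue means having positive multiplicity, which [conj_mup] transfers. *)
  move=> lamG; have := lamG; have chi0 := monic_neq0 (char_poly_monic (adjmx C G)).
  by rewrite !eigenvalue_root_char -!dvdp_XsubCl !(XsubC_dvd _ chi0) (conj_mup _ lamG).
split; last by move=> lam lamG; split; [apply: conj_eig | apply: conj_mup].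
have trace_eq (lam : C) : lam = 2%:R^-1 * (2%:R * lam / d%:R) * d%:R by field.
split=> [per lam lamG | lists].
  have [_ Dlam m_sqf m1] := eigG _ lamG.
  have [t_int t_real t_le] := subdiv_periodic_trace d_gt0 regG per lamG.
  split=> [b0|b0]; rewrite {1}[lam]trace_eq.
    rewrite (rational_traceE _ d0).
    (* With b = 0 the trace is rational and integral, hence an integer between -2 and 2. *)
    have Dt : 2%:R * lam / d%:R = ratr (2%:R * a lam / d%:R).
      by rewrite {1}Dlam b0 rmorph0 mul0r addr0 !rmorphM fmorphV !rmorph_nat.
    rewrite Dt in t_int t_le *.
    have [n Dn] := integral_ratr_int t_int; rewrite Dn ratr_int in t_le *.
    apply/eqP/rational_trace_intr/int_rational_trace.
    by move: t_le; rewrite -!(ler_int C) !rmorphN.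
  rewrite (quadratic_traceE _ d0).
  (* The conjugate is also an eigenvalue of G, so periodicity bounds its trace [s] as well. *)
  have [s_int s_real s_le] := subdiv_periodic_trace d_gt0 regG per (conj_eig _ lamG).
  set t := 2%:R * lam / d%:R in t_int t_real t_le *.
  set s := 2%:R * _ / _ in s_int s_real s_le.
  have Dts : t + s = ratr (4%:R * a lam / d%:R).
    by rewrite /t /s {1}Dlam !rmorphM fmorphV !rmorph_nat /=; field.
  have Dst : t * s =
      ratr (4%:R * (a lam ^+ 2 - b lam ^+ 2 * (m lam)%:~R) / d%:R ^+ 2).
    rewrite !rmorphM fmorphV rmorphB !rmorphM !rmorph_nat rmorph_int /=.
    by rewrite -[(m lam)%:~R]sqrtCK /t /s {1}Dlam; field.
  (* The sum and the product of [t] and [s] are rational and integral, so they are integers. *)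
  have [p Dp] : exists p : int, 4%:R * a lam / d%:R = p%:~R.
    by apply: (@integral_ratr_int C); rewrite -Dts; apply: integral_add.
  have [q Dq] : exists q : int,
      4%:R * (a lam ^+ 2 - b lam ^+ 2 * (m lam)%:~R) / d%:R ^+ 2 = q%:~R.
    by apply: (@integral_ratr_int C); rewrite -Dst; apply: integral_mul.
  rewrite {}Dp ratr_int in Dts; rewrite {}Dq ratr_int in Dst.
  have [/andP[t_ge {}t_le] /andP[s_ge {}s_le]] := (t_le, s_le).
  apply/eqP/(@int_quadratic_trace _ p q).
  - by rewrite -Dts -Dst; ring.
  (* An integer value of [t] would make lam rational, and then the square root of m too, as b is
     nonzero. *)
  - move=> n; apply: contra_neq b0 => Dn; apply/eqP; apply: contraT => b0.
    have b0C : ratr (b lam) != 0 :> C by rewrite fmorph_eq0.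
    have Dt2 : t * d%:R / 2%:R = ratr (a lam) + ratr (b lam) * sqrtC (m lam)%:~R.
      by rewrite -Dlam /t; field.
    case/negP: (sq_irr _ lamG ((n%:~R * d%:R / 2%:R - a lam) / b lam)); apply/eqP.
    rewrite fmorph_div rmorphB !rmorphM fmorphV !rmorph_nat rmorph_int -Dn /=.
    by rewrite Dt2; field.
  (* The four numerical conditions come from (2 - t)(2 - s) >= 0, (t + 2)(s + 2) >= 0, (t - s)^2 >=
     0 and the bounds on t + s. *)
  - rewrite -(ler0z C) (_ : _%:~R = (2%:R - t) * (2%:R - s)).
      by rewrite mulr_ge0 // subr_ge0.
    by rewrite intrD intrB intrM -Dts -Dst; ring.
  - rewrite -(ler0z C) (_ : _%:~R = (t + 2%:R) * (s + 2%:R)).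
      by rewrite mulr_ge0 // -[2%:R]opprK subr_ge0.
    by rewrite !intrD intrM -Dts -Dst; ring.
  - rewrite -subr_ge0 -(ler0z C) (_ : _%:~R = (t - s) ^+ 2).
      by rewrite real_exprn_even_ge0 ?rpredB.
    by rewrite intrB intrM rmorphXn /= -Dts -Dst; ring.
  - rewrite -!(ler_int C) -Dts.
    have -> : (-4)%:~R = - 2%:R - 2%:R :> C by ring.
    have -> : 4%:~R = 2%:R + 2%:R :> C by ring.
    by rewrite !lerD.
apply: (subdiv_trace_periodic d_gt0 regG) => t tG; have [b_eq0 b_neq0] := lists _ tG.
have [/b_eq0|/b_neq0] := eqVneq (b (2%:R^-1 * t * d%:R)) 0.
  by rewrite (rational_traceE _ d0) => /eqP; left.
by rewrite (quadratic_traceE _ d0) => /eqP; right.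
Qed.
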